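(* Let $(\mathcal{I}_{BLip},\|\cdot\|_{\mathcal{I}_{BLip}})$ be a normed two-Lipschitz operator ideal. Then $\mathcal{I}_{BLip}$ is injective if and only if the following holds: for all pointed metric spaces $X_1,X_2$, all Banach spaces $E,G$, every $T\in BLip_0(X_1,X_2;E)$ and every metric injection $u\in\mathcal{L}(E,G)$ such that $u\circ T\in\mathcal{I}_{BLip}(X_1,X_2;G)$, one has $T\in\mathcal{I}_{BLip}(X_1,X_2;E)$ and $\|T\|_{\mathcal{I}_{BLip}}=\|u\circ T\|_{\mathcal{I}_{BLip}}$.
   Context: Let $\mathbb{K}$ be $\mathbb{R}$ or $\mathbb{C}$; all Banach spaces are over $\mathbb{K}$. A pointed metric space is a metric space with a distinguished base point $0$. $Lip_0(X,Y)$ is the set of Lipschitz maps $T:X\to Y$ with $T(0)=0$, $Lip(T)$ is the least Lipschitz constant, and $X^{\#}=Lip_0(X,\mathbb{K})$. $\mathcal{L}(E,F)$ is the space of bounded linear operators. A metric injection is a linear operator $u:E\to G$ with $\|u(e)\|=\|e\|$ for all $e\in E$. Two-Lipschitz operators: a map $T:X_1\times X_2\to E$ ($X_1,X_2$ pointed metric spaces, $E$ Banach) belongs to $BLip_0(X_1,X_2;E)$ if $T(x_1,0)=T(0,x_2)=0$ for all $x_1,x_2$ and there is $C>0$ with $\|T(x_1,x_2)-T(x_1,x_2')-T(x_1',x_2)+T(x_1',x_2')\|\le C\,d(x_1,x_1')d(x_2,x_2')$ for all $x_1,x_1'\in X_1$, $x_2,x_2'\in X_2$. The least such $C$ is $BLip(T)$;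 this is a Banach space norm on $BLip_0(X_1,X_2;E)$. A two-Lipschitz operator ideal $\mathcal{I}_{BLip}$ is a subclass of $BLip_0$ such that for all pointed metric spaces $X_1,X_2$ and Banach spaces $E$ the components $\mathcal{I}_{BLip}(X_1,X_2;E):=BLip_0(X_1,X_2;E)\cap\mathcal{I}_{BLip}$ satisfy: (i) $\mathcal{I}_{BLip}(X_1,X_2;E)$ is a linear subspace of $BLip_0(X_1,X_2;E)$; (ii) for $f_1\in X_1^{\#}$, $f_2\in X_2^{\#}$, $e\in E$, the map $(x_1,x_2)\mapsto f_1(x_1)f_2(x_2)e$ belongs to $\mathcal{I}_{BLip}(X_1,X_2;E)$; (iii) if $f_1\in Lip_0(Z,X_1)$, $f_2\in Lip_0(W,X_2)$, $T\in\mathcal{I}_{BLip}(X_1,X_2;E)$ and $u\in\mathcal{L}(E,F)$, then $u\circ T\circ(f_1,f_2)\in\mathcal{I}_{BLip}(Z,W;F)$. It is a normed two-Lipschitz operator ideal if there is $\|\cdot\|_{\mathcal{I}_{BLip}}:\mathcal{I}_{BLip}\to[0,\infty)$ such that (i') each $(\mathcal{I}_{BLip}(X_1,X_2;E),\|\cdot\|_{\mathcal{I}_{BLip}})$ is a normed space and $BLip(T)\le\|T\|_{\mathcal{I}_{BLip}}$; (ii') $Id_{\mathbb{K}^2}:\mathbb{K}\times\mathbb{K}\to\mathbb{K}$, $(\alpha,\beta)\mapsto\alpha\beta$, has $\|Id_{\mathbb{K}^2}\|_{\mathcal{I}_{BLip}}=1$; (iii') in the situation of (iii), $\|u\circ T\circ(f_1,f_2)\|_{\mathcal{I}_{BLip}}\le\|u\|\,\|T\|_{\mathcal{I}_{BLip}}Lip(f_1)Lip(f_2)$.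 For a Banach space $E$, $B_{E^*}$ is the closed unit ball of $E^*$ and $J_E:E\to\ell_\infty(B_{E^*})$ is $J_E(y)=(\langle y,y^*\rangle)_{y^*\in B_{E^*}}$. The injective hull $\mathcal{I}_{BLip}^{inj}$ consists of those $T\in BLip_0(X_1,X_2;E)$ with $J_E\circ T\in\mathcal{I}_{BLip}(X_1,X_2;\ell_\infty(B_{E^*}))$, with $\|T\|_{\mathcal{I}_{BLip}^{inj}}:=\|J_E\circ T\|_{\mathcal{I}_{BLip}}$. The normed ideal $\mathcal{I}_{BLip}$ is injective if $\mathcal{I}_{BLip}=\mathcal{I}_{BLip}^{inj}$ and, moreover, $\|\cdot\|_{\mathcal{I}_{BLip}}=\|\cdot\|_{\mathcal{I}_{BLip}^{inj}}$. *)

(* Defs.v *)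
From HB Require Import structures.
From mathcomp Require Import all_boot all_order all_algebra.
From mathcomp Require Import complex lra.
From mathcomp Require Import all_classical all_reals all_analysis.

Set Implicit Arguments.
Unset Strict Implicit.
Unset Printing Implicit Defensive.

Import Order.TTheory GRing.Theory Num.Theory.
Import numFieldNormedType.Exports.

Local Open Scope classical_set_scope.
Local Open Scope ring_scope.

Variant scalar_kind := RealScalars | ComplexScalars.

Definition scalar_field (R : realType) (k : scalar_kind) : numFieldType :=
  match k with
  | RealScalars => R
  | ComplexScalars => R[i]
  end.

(* Norms on a [normedModType (scalar_field R k)] take values in [scalar_field R k];
   [to_real] and [of_real] translate between them and [R]. *)
Definition to_real (R : realType) (k : scalar_kind) : scalar_field R k -> R :=
  match k return scalar_field R k -> R with
  | RealScalars => id
  | ComplexScalars => @complex.Re R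
  end.

Definition of_real (R : realType) (k : scalar_kind) : R -> scalar_field R k :=
  match k return R -> scalar_field R k with
  | RealScalars => id
  | ComplexScalars => fun x : R => Complex x 0
  end.
Arguments of_real {R} k x.

Definition rnorm (R : realType) (k : scalar_kind)
    (V : normedModType (scalar_field R k)) (v : V) : R := to_real `|v|.

Section scalar_theory.
Context {R : realType} {k : scalar_kind}.
Implicit Types (x y : R) (a b : scalar_field R k).

Lemma of_realK : cancel (@of_real R k) (@to_real R k).
Proof. by case: k. Qed.

Lemma to_realD a b : to_real (a + b) = to_real a + to_real b.
Proof. by case: k a b => [//|[? ?] [? ?]]. Qed.

Lemma of_realD x y : of_real k (x + y) = of_real k x + of_real k y.
Proof. by case: k => //=; rewrite -[0 in LHS]addr0. Qed.

Lemma of_realM x y : of_real k (x * y) = of_real k x * of_real k y.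
Proof.
case: k => //=; apply/eqP; rewrite eq_complex /=.
by rewrite !(mulr0, mul0r) subr0 addr0 !eqxx.
Qed.

Lemma ler_to_real a b : a <= b -> to_real a <= to_real b.
Proof. by case: k a b => [//|a b] /=; rewrite lecE => /andP[]. Qed.

Lemma of_real_le x y : (of_real k x <= of_real k y) = (x <= y).
Proof. by case: k => //=; rewrite lecR. Qed.

Lemma to_realK a : 0 <= a -> of_real k (to_real a) = a.
Proof.
by case: k a => [//|[a1 a2]] /=; rewrite lecE /= => /andP[/eqP-> _].
Qed.

Lemma of_real0 : of_real k (0 : R) = 0.
Proof. by case: k. Qed.

Lemma scalar_complete (F : set_system (scalar_field R k)^o) :
  ProperFilter F -> cauchy F -> cvg F.
Proof.
case: k F => [|] F FF /cauchy_ballP Fc.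
  by apply: (@R_complete R F); apply/cauchy_ballP.
have Fcr (p : R[i]^o -> R^o) :
    (forall z w, `|p z - p w| <= complex.Re `|z - w|) -> cvg (p @ F).
  move=> ple; apply: (@R_complete R (p @ F)); apply/cauchyP => e e0.
  have e0' : 0 < (e%:C)%C :> R[i] by rewrite ltcR.
  have /cauchy_ballP/cauchyP/(_ _ e0')[z Fz] := Fc; exists (p z).
  change (F (p @^-1` ball (p z) e)).
  apply: filterS Fz => w; rewrite /preimage /ball /= => zw.
  by apply: le_lt_trans (ple _ _) _; move: zw; rewrite ltcE => /andP[].
have Fcv (p : R[i]^o -> R^o) :
    (forall z w, `|p z - p w| <= complex.Re `|z - w|) ->
    exists l : R, forall e, 0 < e -> \forall z \near F, `|l - p z| < e.
  move=> /Fcr /cvg_ex[l /cvgrPdist_lt pl]; exists l => e /pl; exact.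
have [|a Fa] := Fcv (@complex.Re R).
  move=> [z1 z2] [w1 w2] /=; rewrite -sqrtr_sqr ler_wsqrtr //.
  by rewrite lerDl sqr_ge0.
have [|b Fb] := Fcv (@complex.Im R).
  move=> [z1 z2] [w1 w2] /=; rewrite -sqrtr_sqr ler_wsqrtr //.
  by rewrite lerDr sqr_ge0.
apply/cvg_ex; exists (Complex a b : R[i]^o); apply/cvgrPdist_lt => /= e e0.
have [e1 ee] : exists e1 : R, e = (e1%:C)%C.
  by exists (complex.Re e); rewrite RRe_real // gtr0_real.
have e10 : 0 < e1 by move: e0; rewrite ee ltcR.
have e20 : 0 < e1 / 2 by rewrite divr_gt0.
near=> z; rewrite ee.
have za : `|a - complex.Re z| < e1 / 2 by near: z; exact: Fa.
have zb : `|b - complex.Im z| < e1 / 2 by near: z; exact: Fb.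
set z1 := complex.Re z in za; set z2 := complex.Im z in zb.
have -> : (Complex a b : R[i]) - z = Complex (a - z1) (b - z2).
  by rewrite /z1 /z2; case: (z).
rewrite normc_def /= ltcR.
rewrite -(ger0_norm (ltW e10)) -sqrtr_sqr ltr_sqrt ?exprn_gt0 //.
rewrite -(real_normK (num_real (a - z1))) -(real_normK (num_real (b - z2))).
have := normr_ge0 (a - z1); have := normr_ge0 (b - z2); nra.
Unshelve. all: by end_near. Qed.

End scalar_theory.

Section rnorm_theory.
Context {R : realType} {k : scalar_kind} {V : normedModType (scalar_field R k)}.
Implicit Types v w : V.

Lemma rnormE v : of_real k (rnorm v) = `|v|.
Proof. by rewrite to_realK. Qed.

Lemma rnorm_ge0 v : 0 <= rnorm v.
Proof. by rewrite -(of_real_le (k := k)) rnormE of_real0. Qed.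

Lemma ler_rnormD v w : rnorm (v + w) <= rnorm v + rnorm w.
Proof. by rewrite -(of_real_le (k := k)) of_realD !rnormE ler_normD. Qed.

Lemma rnormZ a v : rnorm (a *: v) = rnorm (a : (scalar_field R k)^o) * rnorm v.
Proof.
by apply: (can_inj (@of_realK R k)); rewrite of_realM rnormE normrZ to_realK // rnormE.
Qed.

Lemma rnorm0_eq0 v : rnorm v = 0 -> v = 0.
Proof. by move=> v0; apply: normr0_eq0; rewrite -rnormE v0 of_real0. Qed.

End rnorm_theory.

(* An alias, because the library instance making [R^o] complete for
   [R : realType] already occupies the head [^o]. *)
Definition scalar_banach (R : realType) (k : scalar_kind) : Type :=
  (scalar_field R k)^o.
HB.instance Definition _ (R : realType) (k : scalar_kind) :=
  NormedModule.copy (scalar_banach R k) (scalar_field R k)^o.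
HB.instance Definition _ (R : realType) (k : scalar_kind) :=
  Uniform_isComplete.Build (scalar_banach R k) (@scalar_complete R k).

#[short(type="pmetricType")]
HB.structure Definition PointedMetric (R : numDomainType) :=
  {M of Metric R M & isPointed M}.

(* Pointed at [0], with an [R]-valued distance; an alias again, because
   [(scalar_field R k)^o] already carries a pseudometric with values in
   [scalar_field R k]. *)
Definition scalar_metric (R : realType) (k : scalar_kind) : Type := scalar_field R k.
HB.instance Definition _ (R : realType) (k : scalar_kind) :=
  Choice.copy (scalar_metric R k) (scalar_field R k).

Section scalar_metric.
Variables (R : realType) (k : scalar_kind).
Implicit Types a b c : scalar_metric R k.

Definition scalar_dist a b : R := rnorm ((a : (scalar_field R k)^o) - b).

Let scalar_distxx a : scalar_dist a a = 0.
Proof.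
by rewrite /scalar_dist /rnorm subrr normr0 -(of_real0 (k := k)) of_realK.
Qed.

Let scalar_dist_positivity a b : scalar_dist a b = 0 -> a = b.
Proof. by move=> /rnorm0_eq0/subr0_eq. Qed.

Let scalar_dist_sym a b : scalar_dist a b = scalar_dist b a.
Proof. by rewrite /scalar_dist /rnorm distrC. Qed.

Let scalar_dist_triangle b a c :
  scalar_dist a c <= scalar_dist a b + scalar_dist b c.
Proof.
by rewrite /scalar_dist -(subrKA (b : (scalar_field R k)^o)); exact: ler_rnormD.
Qed.

HB.instance Definition _ := isMetric.Build R (scalar_metric R k)
  scalar_distxx scalar_dist_positivity scalar_dist_sym scalar_dist_triangle.
HB.instance Definition _ :=
  isPointed.Build (scalar_metric R k) (0 : scalar_field R k).

End scalar_metric.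

Section linf.
Variables (R : realType) (k : scalar_kind) (S : Type).
Local Notation K := (scalar_field R k).

Definition linf_pred : {pred S -> K^o} :=
  fun f => `[< exists M : R, forall s, rnorm (f s) <= M >].

Lemma linf_submod_closed : submod_closed linf_pred.
Proof.
split.
  apply/asboolP; exists 0 => s.
  rewrite /rnorm [X in `|X|](_ : _ = 0) // normr0 -(of_real0 (k := k)).
  by rewrite of_realK.
move=> a f g /asboolP[Mf fM] /asboolP[Mg gM]; apply/asboolP.
exists (rnorm (a : K^o) * Mf + Mg) => s.
apply: le_trans (ler_rnormD (a *: f s) (g s)) _.
by rewrite rnormZ lerD // ler_wpM2l // rnorm_ge0.
Qed.

HB.instance Definition _ :=
  GRing.isSubmodClosed.Build _ _ linf_pred linf_submod_closed.

Record linf : Type := MkLinf {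
  linf_val :> S -> K^o;
  _ : linf_val \in linf_pred
}.

HB.instance Definition _ := [isSub for linf_val].
HB.instance Definition _ := [Choice of linf by <:].
HB.instance Definition _ := [SubChoice_isSubLmodule of linf by <:].

Definition linf_norm (f : linf) : R := sup [set rnorm (f s) | s in [set: S]].

Lemma rnorm_le_linf_norm (f : linf) s : rnorm (f s) <= linf_norm f.
Proof.
have /asboolP[M fM] := valP f.
apply: ub_le_sup; last by exists s.
by exists M => _ [t _ <-]; exact: fM.
Qed.

Lemma linf_norm_le (f : linf) (M : R) :
  0 <= M -> (forall s, rnorm (f s) <= M) -> linf_norm f <= M.
Proof.
move=> M0 fM; rewrite /linf_norm.
have [->|/set0P ne] := eqVneq [set rnorm (f s) | s in [set: S]] set0.
  by rewrite sup0.
by apply: ge_sup => // _ [t _ <-]; exact: fM.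
Qed.

Lemma linf_norm_ge0 (f : linf) : 0 <= linf_norm f.
Proof.
rewrite /linf_norm.
have [->|/set0P[_ [s _ _]]] := eqVneq [set rnorm (f s) | s in [set: S]] set0.
  by rewrite sup0.
exact: le_trans (rnorm_ge0 _) (rnorm_le_linf_norm f s).
Qed.

Let norm (f : linf) : K := of_real k (linf_norm f).

Let ler_linf_normD f g : norm (f + g) <= norm f + norm g.
Proof.
rewrite /norm -of_realD of_real_le; apply: linf_norm_le.
  by rewrite addr_ge0 // linf_norm_ge0.
move=> s; apply: le_trans (ler_rnormD (f s) (g s)) _.
by rewrite lerD // rnorm_le_linf_norm.
Qed.

Let linf_normZ (a : K) f : norm (a *: f) = `|a| * norm f.
Proof.
rewrite /norm -(rnormE (a : K^o)) -of_realM; congr of_real.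
have le_scale (b : K) (g : linf) :
    linf_norm (b *: g) <= rnorm (b : K^o) * linf_norm g.
  apply: linf_norm_le; first by rewrite mulr_ge0 ?rnorm_ge0 ?linf_norm_ge0.
  move=> s; rewrite [X in rnorm X](_ : _ = b *: g s) // rnormZ.
  by rewrite ler_wpM2l ?rnorm_ge0 ?rnorm_le_linf_norm.
have [->|a0] := eqVneq a 0.
  have -> : rnorm (0 : K^o) = 0.
    by rewrite /rnorm normr0 -(of_real0 (k := k)) of_realK.
  rewrite scale0r mul0r; apply/eqP; rewrite eq_le linf_norm_ge0 andbT.
  by have := le_scale 0 0; rewrite scale0r /rnorm normr0
    -(of_real0 (k := k)) of_realK mul0r.
apply/eqP; rewrite eq_le le_scale /=.
have a_gt0 : 0 < rnorm (a : K^o).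
  rewrite lt_neqAle rnorm_ge0 andbT eq_sym; apply/eqP => /rnorm0_eq0 /eqP.
  exact/negP.
rewrite mulrC -ler_pdivlMr // mulrC.
have -> : (rnorm (a : K^o))^-1 = rnorm (a^-1 : K^o).
  apply: (mulfI (lt0r_neq0 a_gt0)); rewrite divff ?lt0r_neq0 //.
  rewrite -[RHS](rnormZ (V := K^o)) /GRing.scale /= divff //.
  by rewrite /rnorm normr1; case: (k).
by have := le_scale a^-1 (a *: f); rewrite scalerA mulVf // scale1r.
Qed.

Let linf_norm0_eq0 f : norm f = 0 -> f = 0.
Proof.
rewrite /norm -(of_real0 (k := k)) => /(can_inj (@of_realK R k)) f0.
apply/val_inj/funext => s; apply: rnorm0_eq0; apply/eqP.
by rewrite eq_le rnorm_ge0 andbT -f0 rnorm_le_linf_norm.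
Qed.

HB.instance Definition _ :=
  Lmodule_isNormed.Build K linf ler_linf_normD linf_normZ linf_norm0_eq0.

Lemma linf_complete (F : set_system linf) :
  ProperFilter F -> cauchy F -> cvg F.
Proof.
move=> FF Fc.
have le_val (f h : linf) s : `|f s - h s| <= `|f - h|.
  by rewrite -(rnormE (f s - h s)) of_real_le (rnorm_le_linf_norm (f - h) s).
have small (e : K) : 0 < e -> exists h : linf, F [set f | `|h - f| < e].
  move=> e0; have /cauchyP/(_ _ e0)[h Fh] := Fc; exists h.
  by apply: filterS Fh => f; rewrite -ball_normE.
have cv s : exists l : K^o, forall e : K, 0 < e ->
    \forall f \near F, `|l - (f : linf) s| < e.
  pose ev (f : linf) : K^o := f s.
  suff /cvg_ex[l /cvgrPdist_lt evl] : cvg (ev @ F).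
    by exists l => e /evl; exact.
  apply: scalar_complete; apply/cauchyP => e /small[h Fh]; exists (h s).
  change (F (ev @^-1` ball (h s) e)).
  apply: filterS Fh => f; rewrite /preimage /ball /= => hf.
  exact: le_lt_trans (le_val _ _ _) hf.
pose g s : K^o := projT1 (cid (cv s)).
have gP s (e : K) : 0 < e -> \forall f \near F, `|g s - (f : linf) s| < e.
  by rewrite /g; case: (cid (cv s)) => l /= lP; exact: lP.
have gunif (e : K) : 0 < e ->
    \forall f \near F, forall s, `|g s - (f : linf) s| <= e.
  move=> e0.
  have e20 : 0 < e / 2 by rewrite divr_gt0.
  have [h Fh] := small _ (divr_gt0 e20 (ltr0Sn K 1)).
  apply: (filterS _ Fh) => f /= hf s.
  have [f' [/= hf' gf']] := filter_ex (filterI Fh (gP s _ e20)).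
  rewrite (splitr e) -(subrKA (f' s)).
  apply: le_trans (ler_normD _ _) _; apply: lerD; first exact: ltW.
  rewrite -(subrKA (h s)) (splitr (e / 2)).
  apply: le_trans (ler_normD _ _) _; rewrite lerD //.
    by rewrite distrC (le_trans (le_val _ _ _)) // ltW.
  by rewrite (le_trans (le_val _ _ _)) // ltW.
have gb : g \in linf_pred.
  have [f /= gf] := filter_ex (gunif 1 ltr01).
  apply/asboolP; exists (1 + linf_norm f) => s.
  rewrite -[g s](subrK (f s)); apply: le_trans (ler_rnormD _ _) _.
  rewrite lerD ?rnorm_le_linf_norm //.
  rewrite -(of_real_le (k := k)) rnormE; apply: le_trans (gf s) _.
  by case: (k).
apply/cvg_ex; exists (MkLinf gb); apply/cvgrPdist_le => e e0.
have := gunif e e0; apply: filterS => f gf.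
rewrite -(to_realK (ltW e0)) of_real_le; apply: linf_norm_le.
  by rewrite -(of_real_le (k := k)) of_real0 to_realK // ltW.
by move=> s; apply: ler_to_real; exact: gf.
Qed.

HB.instance Definition _ := Uniform_isComplete.Build linf linf_complete.

End linf.

Section two_lipschitz.
Variables (R : realType) (k : scalar_kind).
Local Notation K := (scalar_field R k).
Local Notation banachType := (completeNormedModType K).

Definition opnorm (E F : banachType) (u : E -> F) : R :=
  inf [set C : R | 0 <= C /\ forall x, rnorm (u x) <= C * rnorm x].

Definition lip_bound (X Y : pmetricType R) (f : X -> Y) (C : R) : Prop :=
  0 <= C /\ forall x y, mdist (f x) (f y) <= C * mdist x y.

Definition Lip0 (X Y : pmetricType R) : set (X -> Y) :=
  [set f | f point = point /\ exists C, lip_bound f C].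

Definition Lip (X Y : pmetricType R) (f : X -> Y) : R :=
  inf [set C | lip_bound f C].

Definition blip_bound (X1 X2 : pmetricType R) (E : banachType)
    (T : X1 -> X2 -> E) (C : R) : Prop :=
  0 <= C /\ forall x1 x1' x2 x2',
    rnorm (T x1 x2 - T x1 x2' - T x1' x2 + T x1' x2')
      <= C * mdist x1 x1' * mdist x2 x2'.

Definition BLip0 (X1 X2 : pmetricType R) (E : banachType) :
    set (X1 -> X2 -> E) :=
  [set T | [/\ forall x1, T x1 point = 0, forall x2, T point x2 = 0
             & exists2 C, 0 < C & blip_bound T C]].

Definition BLip (X1 X2 : pmetricType R) (E : banachType)
    (T : X1 -> X2 -> E) : R :=
  inf [set C | blip_bound T C].

Definition two_lip_class : Type :=
  forall (X1 X2 : pmetricType R) (E : banachType), set (X1 -> X2 -> E).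

(* Only the values on the members of the ideal are meaningful. *)
Definition two_lip_norm : Type :=
  forall (X1 X2 : pmetricType R) (E : banachType), (X1 -> X2 -> E) -> R.

Record is_two_lip_ideal (I : two_lip_class) : Prop := {
  ideal_sub : forall (X1 X2 : pmetricType R) (E : banachType),
    I X1 X2 E `<=` @BLip0 X1 X2 E ;
  ideal0 : forall (X1 X2 : pmetricType R) (E : banachType),
    I X1 X2 E (fun _ _ => 0) ;
  idealD : forall (X1 X2 : pmetricType R) (E : banachType)
    (S T : X1 -> X2 -> E),
    I X1 X2 E S -> I X1 X2 E T -> I X1 X2 E (fun x1 x2 => S x1 x2 + T x1 x2) ;
  idealZ : forall (X1 X2 : pmetricType R) (E : banachType) (a : K)
    (T : X1 -> X2 -> E),
    I X1 X2 E T -> I X1 X2 E (fun x1 x2 => a *: T x1 x2) ;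
  ideal_rank1 : forall (X1 X2 : pmetricType R) (E : banachType)
    (f1 : X1 -> scalar_metric R k) (f2 : X2 -> scalar_metric R k) (e : E),
    Lip0 f1 -> Lip0 f2 ->
    I X1 X2 E (fun x1 x2 => ((f1 x1 : K) * (f2 x2 : K)) *: e) ;
  ideal_comp : forall (X1 X2 Z W : pmetricType R) (E F : banachType)
    (f1 : Z -> X1) (f2 : W -> X2) (T : X1 -> X2 -> E) (u : {linear E -> F}),
    Lip0 f1 -> Lip0 f2 -> I X1 X2 E T -> continuous u ->
    I Z W F (fun z w => u (T (f1 z) (f2 w)))
}.

Record is_normed_two_lip_ideal (I : two_lip_class) (N : two_lip_norm) :
    Prop := {
  normed_ideal : is_two_lip_ideal I ;
  inorm_ge0 : forall (X1 X2 : pmetricType R) (E : banachType)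
    (T : X1 -> X2 -> E), I X1 X2 E T -> 0 <= N X1 X2 E T ;
  inorm0_eq0 : forall (X1 X2 : pmetricType R) (E : banachType)
    (T : X1 -> X2 -> E), I X1 X2 E T -> N X1 X2 E T = 0 ->
    forall x1 x2, T x1 x2 = 0 ;
  inormZ : forall (X1 X2 : pmetricType R) (E : banachType) (a : K)
    (T : X1 -> X2 -> E), I X1 X2 E T ->
    N X1 X2 E (fun x1 x2 => a *: T x1 x2)
      = rnorm (a : scalar_banach R k) * N X1 X2 E T ;
  ler_inormD : forall (X1 X2 : pmetricType R) (E : banachType)
    (S T : X1 -> X2 -> E), I X1 X2 E S -> I X1 X2 E T ->
    N X1 X2 E (fun x1 x2 => S x1 x2 + T x1 x2) <= N X1 X2 E S + N X1 X2 E T ;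
  BLip_le_inorm : forall (X1 X2 : pmetricType R) (E : banachType)
    (T : X1 -> X2 -> E), I X1 X2 E T -> BLip T <= N X1 X2 E T ;
  inorm_id : N (scalar_metric R k) (scalar_metric R k) (scalar_banach R k)
    (fun a b => (a : K) * (b : K)) = 1 ;
  inorm_comp : forall (X1 X2 Z W : pmetricType R) (E F : banachType)
    (f1 : Z -> X1) (f2 : W -> X2) (T : X1 -> X2 -> E) (u : {linear E -> F}),
    Lip0 f1 -> Lip0 f2 -> I X1 X2 E T -> continuous u ->
    N Z W F (fun z w => u (T (f1 z) (f2 w)))
      <= opnorm u * N X1 X2 E T * Lip f1 * Lip f2
}.

Record dual_ball (E : banachType) : Type := MkDualBall {
  dual_val :> {linear E -> scalar_banach R k} ;
  dual_continuous : continuous dual_val ;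
  dual_opnorm : opnorm dual_val <= 1
}.

Lemma dual_ball_le (E : banachType) (phi : dual_ball E) (y : E) :
  rnorm (phi y) <= rnorm y.
Proof.
have phi_bounded : exists C : R,
    0 <= C /\ forall x, rnorm (phi x) <= C * rnorm x.
  have /linear_bounded_continuous/linear_boundedP := @dual_continuous _ phi.
  move=> /pinfty_ex_gt0[r r0 Hr]; exists (to_real r); split.
    by rewrite -(of_real_le (k := k)) of_real0 to_realK // ltW.
  move=> x; rewrite -(of_real_le (k := k)) of_realM !rnormE to_realK; last exact: ltW.
  exact: Hr.
apply/ler_addgt0Pr => e e0.
have y1 : 0 < 1 + rnorm y by rewrite ltr_pwDl // rnorm_ge0.
have lt_inf : opnorm phi < 1 + e / (1 + rnorm y).
  by apply: le_lt_trans (dual_opnorm phi) _; rewrite ltrDl divr_gt0.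
have phi_inf : has_inf
    [set C : R | 0 <= C /\ forall x, rnorm (phi x) <= C * rnorm x].
  by split; [exact: phi_bounded | exists 0; by move=> C []].
have [C [_ phiC] ltC] := inf_lt (proj1 phi_inf) lt_inf.
apply: le_trans (phiC y) _.
apply: le_trans (ler_wpM2r (rnorm_ge0 _) (ltW ltC)) _.
rewrite mulrDl mul1r lerD2l -mulrA ler_piMr ?ltW //.
by rewrite [ltLHS]mulrC ltr_pdivrMr // mul1r ltrDr.
Qed.

Lemma canonical_embedding_subproof (E : banachType) (y : E) :
  (fun phi : dual_ball E => phi y : (scalar_field R k)^o)
    \in @linf_pred R k (dual_ball E).
Proof. by apply/asboolP; exists (rnorm y) => phi; exact: dual_ball_le. Qed.

Definition canonical_embedding (E : banachType) (y : E) :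
    linf R k (dual_ball E) :=
  MkLinf (canonical_embedding_subproof y).

Definition J_comp (X1 X2 : pmetricType R) (E : banachType)
    (T : X1 -> X2 -> E) : X1 -> X2 -> linf R k (dual_ball E) :=
  fun x1 x2 => canonical_embedding (T x1 x2).

Definition inj_hull (I : two_lip_class) : two_lip_class :=
  fun X1 X2 E =>
    [set T | BLip0 T /\ I X1 X2 (linf R k (dual_ball E)) (J_comp T)].

Definition inj_hull_norm (N : two_lip_norm) : two_lip_norm :=
  fun X1 X2 E T => N X1 X2 (linf R k (dual_ball E)) (J_comp T).

Definition injective_ideal (I : two_lip_class) (N : two_lip_norm) : Prop :=
  (forall (X1 X2 : pmetricType R) (E : banachType),
     I X1 X2 E = @inj_hull I X1 X2 E) /\
  (forall (X1 X2 : pmetricType R) (E : banachType) (T : X1 -> X2 -> E),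
     I X1 X2 E T -> N X1 X2 E T = inj_hull_norm N T).

Definition metric_injection (E G : banachType) (u : {linear E -> G}) : Prop :=
  forall e, rnorm (u e) = rnorm e.

End two_lipschitz.

(* Main.v *)
Require Import Defs.
From HB Require Import structures.
From mathcomp Require Import all_boot all_order all_algebra.
From mathcomp Require Import complex lra.
From mathcomp Require Import all_classical all_reals all_analysis.

Import Order.TTheory GRing.Theory Num.Theory.
Import numFieldNormedType.Exports.

Local Open Scope classical_set_scope.
Local Open Scope ring_scope.

Set Implicit Arguments.
Unset Strict Implicit.
Unset Printing Implicit Defensive.

(** The theorem rests on two facts about the canonical embedding
    [J_E : E -> linf (B E)], where [B E] is the unit ball of the
    dual of [E]. First, it is itself a metric injection, so the property on
    the right-hand side, applied to [u = J_E], says that the injective hull is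
    contained in the ideal with the same norm; the ideal is
    always contained in its hull, [J_E] being linear and bounded. Secondly,
    [linf (B E)] has the extension property that makes [J_E] universal: if
    [u : E -> G] is any metric injection, then [J_E = v \o u] for some linear
    contraction [v : G -> linf (B E)] ([canonical_embedding_factor]). Hence
    [u \o T] in the ideal gives [J_E \o T = v \o (u \o T)] in the ideal, with
    [N (J_E \o T) <= N (u \o T)]; if the ideal is injective this puts [T] in
    it with [N T <= N (u \o T)], and the reverse inequality holds because [u]
    is a contraction.

    Both facts are instances of one form of the Hahn-Banach theorem
    ([contraction_extension]): along a metric injection [u : E -> G], every
    functional in [B E] is the restriction of one in [B G]. The map [v] collects such extensions, one per functional,
    and [J_E] is isometric since the functional [a |-> a] extends along the
    metric injection [a |-> (a / |y|) y] from the scalars to [E].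

    The extension is obtained for both scalar fields at once. The real part
    of the functional is extended as an [R]-linear form dominated by the norm
    ([hahn_banach]); a scalar-valued form with that real part exists
    ([real_part_extension]); and since multiplying the argument by a scalar of
    modulus one makes any value real and nonnegative ([rotate_to_real]), a
    linear form is bounded by the norm as soon as its real part is, and is
    determined by its real part. *)

(** * The Hahn-Banach theorem for real vector spaces *)

Section hahn_banach.
Variables (R : realType) (V : lmodType R) (p : V -> R).
Hypothesis pD : forall x y, p (x + y) <= p x + p y.
Hypothesis pZ : forall (t : R) x, 0 <= t -> p (t *: x) = t * p x.

Implicit Types (A B : set (V * R^o)).

(** Partially defined linear forms dominated by [p], encoded as linear
    subspaces of [V * R], or the empty set, lying below the graph of [p]. Being the graph of a
    function need not be imposed (see [dominated_graph_fun]), so that both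
    one-dimensional extensions and unions of chains are elementary. *)
Definition dominated_graph A : Prop :=
  (forall (c : R) z w, A z -> A w -> A (c *: z + w)) /\
  (forall z, A z -> z.2 <= p z.1).

Lemma dominated_graph0 A : A !=set0 -> dominated_graph A -> A 0.
Proof.
move=> [z Az] [AL _]; have := AL (-1) z z Az Az.
by rewrite scaleN1r addNr.
Qed.

Lemma dominated_graphZ A c z :
  A !=set0 -> dominated_graph A -> A z -> A (c *: z).
Proof.
move=> A0 dA Az; rewrite -[_ *: _]addr0.
by apply: dA.1 => //; exact: dominated_graph0.
Qed.

(** Two values [a], [b] above [x] put [(0, a - b)] in the graph, whence
    [a - b <= p 0 = 0]. *)
Lemma dominated_graph_fun A x a b :
  dominated_graph A -> A (x, a) -> A (x, b) -> a = b.
Proof.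
move=> dA Aa Ab.
have p0 : p 0 = 0 by rewrite -(scale0r 0) pZ // mul0r.
have le c d : A (x, c) -> A (x, d) -> c <= d.
  move=> Ac Ad; have := dA.2 _ (dA.1 (-1) _ _ Ad Ac).
  by rewrite /= !scaleN1r addNr p0 addrC subr_le0.
by apply/eqP; rewrite eq_le !le.
Qed.

(** The value [r] at [v0] must satisfy [b - p (y - v0) <= r <= p (x + v0) - a]
    for all [(x, a)] and [(y, b)] in the graph. By subadditivity every lower
    bound is at most every upper bound, so the supremum of the lower bounds
    will do; homogeneity then gives domination at [x + t v0], according to the
    sign of [t]. *)
Lemma dominated_graph_extend A v0 :
  A !=set0 -> dominated_graph A ->
  exists B, [/\ dominated_graph B, A `<=` B & exists b, B (v0, b)].
Proof.
move=> A0 dA; have A00 := dominated_graph0 A0 dA.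
pose L := [set z.2 - p (z.1 - v0) | z in A].
have L_le w : A w -> ubound L (p (w.1 + v0) - w.2).
  move=> Aw _ [z Az <-].
  have := dA.2 _ (dA.1 1 _ _ Az Aw); rewrite scale1r /=.
  have := pD (z.1 - v0) (w.1 + v0); rewrite addrACA addNr addr0.
  lra.
have L0 : L !=set0 by exists (0 - p (0 - v0)), 0.
have r_le w : A w -> sup L <= p (w.1 + v0) - w.2.
  by move=> Aw; apply: ge_sup => //; exact: L_le.
have r_ge z : A z -> z.2 - p (z.1 - v0) <= sup L.
  move=> Az; apply: ub_le_sup; last by exists z.
  by exists (p (0 + v0) - 0); exact: (L_le 0).
have p_rescale t x y : 0 < t -> t * p (t^-1 *: x + y) = p (x + t *: y).
  by move=> t0; rewrite -pZ ?ltW // scalerDr scalerA divff ?gt_eqF ?scale1r.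
exists [set u | exists2 z, A z & exists t, u = z + t *: (v0, sup L)]; split.
- split=> [c _ _ [z Az [t ->]] [w Aw [s ->]]|_ [z Az [t ->]]].
    exists (c *: z + w); first exact: dA.1.
    by exists (c * t + s); rewrite scalerDr scalerA addrACA -scalerDl.
  change (z.2 + t * sup L <= p (z.1 + t *: v0)).
  have [t0|t0|->] := ltgtP t 0; last first.
  + by rewrite scale0r mul0r !addr0; exact: dA.2.
  + have := r_le _ (dominated_graphZ t^-1 A0 dA Az).
    rewrite -(ler_pM2l t0) mulrBr p_rescale // mulrA divff ?gt_eqF // mul1r.
    lra.
  + have s0 : 0 < - t by rewrite oppr_gt0.
    have := r_ge _ (dominated_graphZ (- t)^-1 A0 dA Az).
    rewrite -(ler_pM2l s0) mulrBr p_rescale // mulrA divff ?gt_eqF // mul1r.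
    by rewrite scalerN scaleNr opprK; lra.
- by move=> z Az; exists z => //; exists 0; rewrite scale0r addr0.
- by exists (sup L), 0 => //; exists 1; rewrite scale1r add0r.
Qed.

Lemma dominated_graph_maximal A : A !=set0 -> dominated_graph A ->
  exists B, [/\ dominated_graph B, A `<=` B & forall v, exists b, B (v, b)].
Proof.
move=> A0 dA.
(* The condition [B !=set0] lets the empty union, that of the empty chain,
   satisfy [P]. *)
pose P B := dominated_graph B /\ (B !=set0 -> A `<=` B).
have [F FP totF|B [[dB AB] maxB]] := @Zorn_bigcup _ P.
  split; last first.
    move=> [z [B FB Bz]]; apply: subset_trans (bigcup_sup FB).
    by apply: (FP _ FB).2; exists z.
  split=> [c z w [B FB Bz] [C FC Cw]|z [B FB]]; last exact: (FP _ FB).1.2.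
  have [BC|CB] := totF _ _ FB FC.
    by exists C => //; apply: (FP _ FC).1.1 => //; exact: BC.
  by exists B => //; apply: (FP _ FB).1.1 => //; exact: CB.
have B0 : B !=set0.
  apply/set0P/eqP => B0; case: A0 => z Az.
  apply: (maxB A); last (split; [exact: dA|by move=> _]).
  by rewrite B0; split=> [//|/(_ _ Az)].
exists B; split; [by []|exact: AB|move=> v].
have [C [dC BC [c Cv]]] := dominated_graph_extend v B0 dB.
exists c; apply: contrapT => nBv; apply: (maxB C).
  by split=> // CB; exact/nBv/CB.
by split=> // _; exact: subset_trans (AB B0) BC.
Qed.

Theorem hahn_banach A : A !=set0 -> dominated_graph A ->
  exists g : {linear V -> R^o},
    (forall z, A z -> g z.1 = z.2) /\ (forall x, g x <= p x).
Proof.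
move=> A0 dA; have [B [dB AB Btot]] := dominated_graph_maximal A0 dA.
have /choice[g gB] := Btot.
have g_lin : linear g.
  move=> c x y; apply: (dominated_graph_fun dB (gB _)).
  exact: (dB.1 c (x, g x) (y, g y)).
pose gm := GRing.isLinear.Build _ _ _ _ g g_lin.
pose gL : {linear V -> R^o} := HB.pack g gm.
exists gL; split=> [[x a] Az|x]; last exact: dB.2 (gB x).
exact: dominated_graph_fun dB (gB x) (AB _ Az).
Qed.

End hahn_banach.

(** * Scalars and real parts *)

Section scalars.
Variables (R : realType) (k : scalar_kind).
Local Notation K := (scalar_field R k).

Lemma of_real1 : of_real k 1 = 1 :> K.
Proof. by case: k. Qed.

Lemma to_realM_of_real (c : R) (z : K) :
  to_real (of_real k c * z) = c * to_real z.
Proof. by case: k z => [//|[a b]] /=; rewrite mul0r subr0. Qed.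

Lemma to_real_le_rnorm (z : K^o) : to_real z <= rnorm z.
Proof.
rewrite /rnorm; case: k z => [z|[a b]]; first exact: ler_norm.
rewrite normc_def /=; apply: le_trans (ler_norm a) _.
by rewrite -sqrtr_sqr ler_wsqrtr // lerDl sqr_ge0.
Qed.

(** In [R[i]], multiplication by [w] is the rotation bringing [z] to the
    nonnegative real axis. *)
Lemma phaseP (z : K) : exists2 w : K, `|w| = 1 & w * z = `|z|.
Proof.
have [->|z0] := eqVneq z 0; first by exists 1; rewrite ?normr1 // normr0 mulr0.
exists (`|z| / z); last by rewrite divfK.
by rewrite normf_div normr_id divff // normr_eq0.
Qed.

End scalars.

(** Restriction of scalars to [R]. An alias is used because [V] already carries
    a module structure over its own scalar field. *)
Definition realified (R : realType) (k : scalar_kind)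
  (V : lmodType (scalar_field R k)) : Type := V.

Section realified.
Variables (R : realType) (k : scalar_kind) (V : lmodType (scalar_field R k)).
Local Notation VR := (realified V).

HB.instance Definition _ := GRing.Zmodule.copy VR V.

Definition real_scale (c : R) (v : VR) : VR := of_real k c *: (v : V).

Let real_scaleA c d v : real_scale c (real_scale d v) = real_scale (c * d) v.
Proof. by rewrite /real_scale scalerA of_realM. Qed.

Let real_scale1 : left_id 1 real_scale.
Proof. by move=> v; rewrite /real_scale of_real1 scale1r. Qed.

Let real_scaleDr : right_distributive real_scale +%R.
Proof. by move=> c v w; exact: scalerDr. Qed.

Let real_scaleDl v : {morph real_scale^~ v : c d / c + d}.
Proof. by move=> c d; rewrite /real_scale of_realD scalerDl. Qed.

HB.instance Definition _ := GRing.Zmodule_isLmodule.Build R VR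
  real_scaleA real_scale1 real_scaleDr real_scaleDl.

End realified.

(** Over the complex numbers, the form is [x |-> g x - i g (i x)]. *)
Lemma real_part_extension (R : realType) (k : scalar_kind)
    (V : lmodType (scalar_field R k)) (g : V -> R) :
  {morph g : x y / x + y} ->
  (forall c x, g (of_real k c *: x) = c * g x) ->
  exists psi : {linear V -> scalar_banach R k},
    forall x, to_real (psi x : scalar_field R k) = g x.
Proof.
case: k V g => V g gD gZ.
  pose f (x : V) : scalar_banach R RealScalars := g x.
  have psi_lin : linear f.
    by move=> a x y; rewrite /f gD gZ.
  pose m := GRing.isLinear.Build _ _ _ _ _ psi_lin.
  pose psi : {linear V -> scalar_banach R RealScalars} := HB.pack f m.
  by exists psi.
pose f (x : V) : scalar_banach R ComplexScalars :=
  Complex (g x) (- g (Complex 0 1 *: x)).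
have psi_lin : linear f.
  move=> [a b] x y.
  have gc (v : V) : g (Complex a b *: v) = a * g v + b * g (Complex 0 1 *: v).
    rewrite -!gZ -gD scalerA -scalerDl /=; congr (g (_ *: v)).
    by apply/eqP; rewrite eq_complex /=; apply/andP; split; apply/eqP; lra.
  have gi (v : V) :
      g (Complex 0 1 *: (Complex a b *: v)) =
      - b * g v + a * g (Complex 0 1 *: v).
    rewrite scalerA -!gZ -gD scalerA -scalerDl /=; congr (g (_ *: v)).
    by apply/eqP; rewrite eq_complex /=; apply/andP; split; apply/eqP; lra.
  rewrite /f scalerDr !gD gc gi.
  by apply/eqP; rewrite eq_complex /=; apply/andP; split; apply/eqP; lra.
pose m := GRing.isLinear.Build _ _ _ _ _ psi_lin.
pose psi : {linear V -> scalar_banach R ComplexScalars} := HB.pack f m.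
by exists psi.
Qed.

Section real_parts.
Variables (R : realType) (k : scalar_kind).
Local Notation K := (scalar_field R k).

Lemma rotate_to_real (V : lmodType K) (psi : {linear V -> scalar_banach R k})
    (x : V) :
  exists2 w : K, `|w| = 1 & to_real (psi (w *: x) : K) = rnorm (psi x).
Proof.
have [w w1 wz] := phaseP (psi x : K); exists w => //.
by rewrite linearZ_LR /rnorm -wz.
Qed.

(** Rotating [x] so that [psi x] becomes nonnegative real leaves [rnorm x]
    unchanged. *)
Lemma rnorm_le_of_real_part (V : normedModType K)
    (psi : {linear V -> scalar_banach R k}) :
  (forall x, to_real (psi x : K) <= rnorm x) ->
  forall x, rnorm (psi x) <= rnorm x.
Proof.
move=> psi_le x; have [w w1 <-] := rotate_to_real psi x.
by apply: le_trans (psi_le _) _; rewrite /rnorm normrZ w1 mul1r.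
Qed.

Lemma eq_of_real_part (V : lmodType K)
    (phi psi : {linear V -> scalar_banach R k}) :
  (forall x, to_real (phi x : K) = to_real (psi x : K)) -> phi =1 psi.
Proof.
move=> eq_re x; apply/eqP; rewrite -subr_eq0; apply/eqP/rnorm0_eq0.
have [w _ /=] := rotate_to_real (phi \- psi) x.
rewrite /= => <-.
apply: (addIr (to_real (psi (w *: x) : K))).
by rewrite -to_realD subrK add0r.
Qed.

End real_parts.

(** * Extension of functionals along metric injections *)

Section functionals.
Variables (R : realType) (k : scalar_kind).
Local Notation K := (scalar_field R k).
Local Notation banachType := (completeNormedModType K).

Lemma contraction_continuous (E F : normedModType K) (u : {linear E -> F}) :
  (forall x, rnorm (u x) <= rnorm x) -> continuous u.
Proof.
move=> u_le; apply/linear_bounded_continuous/linear_boundedP.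
near=> r => x; apply: (@le_trans _ _ `|x|).
  by rewrite -!rnormE of_real_le.
by rewrite ler_peMl //; near: r; exact: nbhs_pinfty_ge.
Unshelve. all: by end_near. Qed.

Lemma opnorm_le1 (E F : banachType) (u : E -> F) :
  (forall x, rnorm (u x) <= rnorm x) -> opnorm u <= 1.
Proof.
move=> u_le; apply: ge_inf; first by exists 0 => C [].
by split=> // x; rewrite mul1r.
Qed.

(** The values [to_real (phi y)] at the points [u y] form a dominated graph in
    [G]: their domination by the norm is where [u] being isometric is used. *)
Lemma contraction_extension (E G : banachType)
    (u : {linear E -> G}) (phi : {linear E -> scalar_banach R k}) :
  metric_injection u -> (forall y, rnorm (phi y) <= rnorm y) ->
  exists psi : dual_ball G, forall y, psi (u y) = phi y.
Proof.
move=> u_iso phi_le.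
pose A : set (realified G * R^o) :=
  [set (u y : realified G, to_real (phi y : K)) | y in [set: E]].
have [||| |g [gA g_le]] := @hahn_banach R (realified G) (@rnorm R k G) _ _ A.
- exact: ler_rnormD.
- move=> t x t0; apply: (etrans (rnormZ (of_real k t) (x : G))); congr (_ * _).
  rewrite /rnorm ger0_norm ?of_realK //.
  by rewrite -(of_real0 (k := k)) of_real_le.
- by exists (u 0 : realified G, to_real (phi 0 : K)), 0.
- split=> [c _ _ [y _ <-] [z _ <-]|_ [y _ <-]] /=; last first.
    by rewrite u_iso; apply: le_trans (phi_le y); exact: to_real_le_rnorm.
  exists (of_real k c *: y + z) => //.
  congr pair; first by rewrite linearP.
  by rewrite linearP to_realD [_ *: _]/(_ * _) to_realM_of_real.
have [psi psi_re] :=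
    real_part_extension (raddfD g) (fun c (x : G) => linearZ_LR g c x).
have psi_le : forall x, rnorm (psi x) <= rnorm x.
  by apply: rnorm_le_of_real_part => x; rewrite psi_re; exact: g_le.
exists (MkDualBall (contraction_continuous psi_le) (opnorm_le1 psi_le)) => y /=.
have eq_re z : to_real ((psi \o u) z : K) = to_real (phi z : K).
  by rewrite /= psi_re; exact: (gA _ (ex_intro2 _ _ z I erefl)).
exact: (eq_of_real_part eq_re).
Qed.

(** Extend the identity functional of the scalar line along the isometric
    embedding [a |-> (a / |y|) y] of that line onto the span of [y]. *)
Lemma norming_functional (E : banachType) (y : E) :
  exists phi : dual_ball E, rnorm (phi y) = rnorm y.
Proof.
have [y0|y0] := eqVneq (rnorm y) 0.
  have z_le (x : E) : rnorm ((\0 : {linear E -> scalar_banach R k}) x)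
      <= rnorm x.
    by rewrite /= /rnorm normr0 ler_to_real.
  exists (MkDualBall (contraction_continuous z_le) (opnorm_le1 z_le)) => /=.
  by rewrite (rnorm0_eq0 y0) /rnorm !normr0.
pose r : K := of_real k (rnorm y)^-1.
pose f0 (a : scalar_banach R k) : E := (a : K) *: (r *: y).
have f_lin : linear f0.
  by move=> a b c; rewrite /f0 [LHS]scalerDl -[in LHS]scalerA.
pose m := GRing.isLinear.Build _ _ _ _ _ f_lin.
pose f : {linear scalar_banach R k -> E} := HB.pack f0 m.
have ry : rnorm (r *: y) = 1.
  rewrite rnormZ /r {1}/rnorm ger0_norm; last first.
    by rewrite -(of_real0 (k := k)) of_real_le invr_ge0 rnorm_ge0.
  by rewrite of_realK mulVf.
have f_iso : metric_injection f.
  by move=> a; rewrite /= rnormZ ry mulr1.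
have [phi phiE] := @contraction_extension _ _ f idfun f_iso (fun _ => lexx _).
exists phi.
have -> : y = f (of_real k (rnorm y)).
  by rewrite /= /f0 scalerA -of_realM mulfV // of_real1 scale1r.
by rewrite phiE f_iso.
Qed.

Lemma canonical_embedding_linear (E : banachType) :
  linear (@canonical_embedding R k E).
Proof. by move=> a x y; apply/val_inj/funext => phi /=; rewrite linearP. Qed.

HB.instance Definition _ (E : banachType) := GRing.isLinear.Build _ _ _ _
  (@canonical_embedding R k E) (@canonical_embedding_linear E).

Lemma rnorm_linf (S : Type) (f : linf R k S) : rnorm f = linf_norm f.
Proof. by rewrite /rnorm /= of_realK. Qed.

Lemma canonical_embedding_metric_injection (E : banachType) :
  metric_injection (@canonical_embedding R k E).
Proof.
move=> y; rewrite rnorm_linf; apply/eqP; rewrite eq_le; apply/andP; split.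
  by apply: linf_norm_le => [|phi]; [exact: rnorm_ge0|exact: dual_ball_le].
have [phi <-] := norming_functional y.
exact: (rnorm_le_linf_norm (canonical_embedding y) phi).
Qed.

(** Coordinatewise extension: the coordinate [phi] of [v x] is [ext phi x],
    where [ext phi] in the dual unit ball of [G] extends [phi] along [u]. The
    choice of the extensions needs no coherence between different [phi],
    since linearity of [v] is only linearity of each [ext phi]. *)
Lemma canonical_embedding_factor (E G : banachType) (u : {linear E -> G}) :
  metric_injection u ->
  exists2 v : {linear G -> linf R k (dual_ball E)},
    forall x, rnorm (v x) <= rnorm x
    & forall y, v (u y) = canonical_embedding y.
Proof.
move=> u_iso.
have /choice[ext extE] : forall phi : dual_ball E,
    exists psi : dual_ball G, forall y, psi (u y) = phi y.
  by move=> phi; apply: contraction_extension => //; exact: dual_ball_le.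
have v_mem x : (fun phi => ext phi x : K^o) \in @linf_pred R k (dual_ball E).
  by apply/asboolP; exists (rnorm x) => phi; exact: dual_ball_le.
pose v0 x := MkLinf (v_mem x).
have v_lin : linear v0.
  by move=> a x y; apply/val_inj/funext => phi /=; rewrite linearP.
pose m := GRing.isLinear.Build _ _ _ _ _ v_lin.
pose v : {linear G -> linf R k (dual_ball E)} := HB.pack v0 m.
exists v => [x|y].
  rewrite rnorm_linf; apply: linf_norm_le => [|phi]; first exact: rnorm_ge0.
  exact: dual_ball_le.
by apply/val_inj/funext => phi /=; rewrite extE.
Qed.

End functionals.

(** * Ideals and metric injections *)

Section ideals.
Variables (R : realType) (k : scalar_kind).
Variables (I : two_lip_class R k) (N : two_lip_norm R k).
Hypothesis IN : is_normed_two_lip_ideal I N.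
Local Notation banachType := (completeNormedModType (scalar_field R k)).

Lemma lip_bound_id (X : pmetricType R) : lip_bound (@idfun X) 1.
Proof. by split=> // x y; rewrite mul1r. Qed.

Lemma Lip_id_le1 (X : pmetricType R) : Lip (@idfun X) <= 1.
Proof. by apply: ge_inf (lip_bound_id X); exists 0 => C []. Qed.

Lemma Lip_ge0 (X Y : pmetricType R) (f : X -> Y) : 0 <= Lip f.
Proof.
rewrite /Lip; have [->|/set0P f0] := eqVneq [set C | lip_bound f C] set0.
  by rewrite inf0.
by apply: lb_le_inf => // C [].
Qed.

Lemma ideal_comp_contraction (X1 X2 : pmetricType R) (E F : banachType)
    (T : X1 -> X2 -> E) (v : {linear E -> F}) :
  (forall x, rnorm (v x) <= rnorm x) -> I T ->
  I (fun x1 x2 => v (T x1 x2)) /\ N (fun x1 x2 => v (T x1 x2)) <= N T.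
Proof.
move=> v_le IT; have v_cont := contraction_continuous v_le.
have id0 (X : pmetricType R) : Lip0 (@idfun X).
  by split=> //; exists 1; exact: lip_bound_id.
split; first exact: (ideal_comp (normed_ideal IN) (id0 X1) (id0 X2) IT v_cont).
apply: le_trans (inorm_comp IN (id0 X1) (id0 X2) IT v_cont) _.
have NT := inorm_ge0 IN IT.
have v0 : 0 <= opnorm v.
  by apply: lb_le_inf => [|C []] //; exists 1; split=> // x; rewrite mul1r.
have vN : opnorm v * N T <= N T by rewrite ler_piMl // opnorm_le1.
have Lip1 (X : pmetricType R) (c : R) : 0 <= c -> c * Lip (@idfun X) <= c.
  by move=> c0; rewrite ler_piMr // Lip_id_le1.
have vN0 : 0 <= opnorm v * N T by exact: mulr_ge0.
apply: (le_trans (Lip1 _ _ _)); first by rewrite mulr_ge0 ?Lip_ge0.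
exact: le_trans (Lip1 _ _ vN0) vN.
Qed.

End ideals.

Theorem theorem3p10 (R : realType) (k : scalar_kind)
    (I : two_lip_class R k) (N : two_lip_norm R k) :
  is_normed_two_lip_ideal I N ->
  (injective_ideal I N <->
   forall (X1 X2 : pmetricType R) (E G : completeNormedModType (scalar_field R k))
     (T : X1 -> X2 -> E) (u : {linear E -> G}),
     BLip0 T -> continuous u -> metric_injection u ->
     I X1 X2 G (fun x1 x2 => u (T x1 x2)) ->
     I X1 X2 E T /\ N X1 X2 E T = N X1 X2 G (fun x1 x2 => u (T x1 x2))).
Proof.
move=> IN; split=> [[hullE normE] X1 X2 E G T u TB _ u_iso IuT|inj_prop].
  have [v v_le vu] := canonical_embedding_factor u_iso.
  have [IJ NJ] := ideal_comp_contraction IN v_le IuT.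
  have JE : (fun x1 x2 => v (u (T x1 x2))) = J_comp T.
    by apply/funext => x1; apply/funext => x2; rewrite vu.
  rewrite JE in IJ NJ.
  have IT : I X1 X2 E T by rewrite hullE; split.
  split=> //; apply/eqP; rewrite eq_le; apply/andP; split.
    by rewrite (normE _ _ _ _ IT).
  by apply: (ideal_comp_contraction IN _ IT).2 => x; rewrite u_iso.
have J_le (E : completeNormedModType (scalar_field R k)) (x : E) :
    rnorm (canonical_embedding x) <= rnorm x.
  by rewrite canonical_embedding_metric_injection.
have J_prop (X1 X2 : pmetricType R)
    (E : completeNormedModType (scalar_field R k)) (T : X1 -> X2 -> E) :
    inj_hull I T -> I X1 X2 E T /\ N X1 X2 E T = inj_hull_norm N T.
  move=> [TB IJ]; apply: (inj_prop _ _ _ _ T (@canonical_embedding R k E)) => //.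
    exact/contraction_continuous/J_le.
  exact: canonical_embedding_metric_injection.
have hull (X1 X2 : pmetricType R)
    (E : completeNormedModType (scalar_field R k)) (T : X1 -> X2 -> E) :
    I X1 X2 E T -> inj_hull I T.
  move=> IT; split; first exact: (ideal_sub (normed_ideal IN)).
  exact: (ideal_comp_contraction IN (@J_le E) IT).1.
split=> [X1 X2 E|X1 X2 E T /hull/J_prop[]//].
by apply/seteqP; split=> T; [exact: hull|move=> /J_prop[]].
Qed.
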